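(* There is no odd positive integer $n=\prod_{i=1}^{\omega(n)}p_i^{n_i}$ (with $p_1,\dots,p_{\omega(n)}$ distinct odd primes) such that $n_i\ge 2$ for every $i$, $\sigma(p_i^{n_i})$ is prime for every $i$, and $n$ is a strong alpha number of order $(1,1)$.
   Context: For a positive integer $n$, $\sigma(n)=\sum_{d\mid n} d$ and $\omega(n)$ is the number of distinct prime divisors of $n$. A positive integer $n$ is a strong alpha number of order $(1,1)$ if there exist coprime positive integers $\alpha_1,\alpha_2$ with $\sigma(n)=\frac{\alpha_1}{\alpha_2}n$ and $2\le \max(\alpha_1,\alpha_2)\le \omega(n)$. *)

(* Defs.v *)
From HB Require Import structures.
From mathcomp Require Import all_boot all_order all_algebra.

Set Implicit Arguments.
Unset Strict Implicit.
Unset Printing Implicit Defensive.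

Definition sigma (n : nat) : nat := \sum_(d <- divisors n) d.

Definition omega (n : nat) : nat := size (primes n).

Definition strong_alpha11 (n : nat) : Prop :=
  0 < n /\
  exists a1 a2 : nat,
    [/\ 0 < a1, 0 < a2, coprime a1 a2,
        ((sigma n)%:R = a1%:R / a2%:R * n%:R :> rat)%R
      & 2 <= maxn a1 a2 <= omega n].

(* Main.v *)
Require Import Defs.
From HB Require Import structures.
From mathcomp Require Import all_boot all_order all_algebra.

(** Write [k = omega n].  Since [sigma] is multiplicative, [sigma n] is a
    product of exactly [k] primes, whereas [n] has at least [2 k] prime factors
    counted with multiplicity.  Hence [sigma n * a2 = a1 * n] forces [a2] to
    have at least [k] prime factors, so [2 ^ k <= a2 <= k], which is absurd. *)

(** Both gcds divide [d] and they are coprime, so their product divides [d]; conversely [d] divides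
    each of [d * d], [d * n], [m * d], [m * n], into which the product of gcds expands. *)
Lemma dvdn_coprime_gcd d m n :
  coprime m n -> d %| m * n -> gcdn d m * gcdn d n = d.
Proof.
move=> co_mn d_dv; apply/eqP; rewrite eqn_dvd; apply/andP; split.
  rewrite Gauss_dvd ?dvdn_gcdl //.
  by apply: coprime_dvdl (dvdn_gcdr d m) _; apply: coprime_dvdr (dvdn_gcdr d n) _.
rewrite muln_gcdl !muln_gcdr !dvdn_gcd d_dv.
by rewrite !(dvdn_mulr _ (dvdnn d)) (dvdn_mull _ (dvdnn d)).
Qed.

Lemma sigma1 : sigma 1 = 1.
Proof. by rewrite /sigma big_seq1. Qed.

(** Multiplication is a bijection from pairs of divisors of [m] and [n] to divisors of [m * n], so
    the divisor sum factors. *)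
Lemma sigmaM m n : 0 < m -> 0 < n -> coprime m n ->
  sigma (m * n) = sigma m * sigma n.
Proof.
move=> m_gt0 n_gt0 co_mn.
(* The gcd with [m] recovers the first factor of [d * d'], which makes the products in [prods]
   distinct. *)
have gcd_div d d' : d %| m -> d' %| n -> gcdn (d * d') m = d.
  move=> dm d'n; rewrite gcdnC Gauss_gcdl; first exact/gcdn_idPr.
  exact: coprime_dvdr d'n co_mn.
pose prods := [seq d * d' | d <- divisors m, d' <- divisors n].
have uniq_prods : uniq prods.
  apply: allpairs_uniq => [||[d d'] [c c']]; rewrite ?divisors_uniq //=.
  case/allpairsP=> -[x x'] /= []; rewrite -!dvdn_divisors // => xm x'n [-> ->].
  case/allpairsP=> -[y y'] /= []; rewrite -!dvdn_divisors // => ym y'n [-> ->].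
  move=> eq_xy; have eqx : x = y by rewrite -(gcd_div _ _ xm x'n) eq_xy gcd_div.
  move/eqP: eq_xy; rewrite eqx eqn_pmul2l ?(dvdn_gt0 m_gt0) // => /eqP->.
  by [].
have perm_prods : perm_eq (divisors (m * n)) prods.
  apply: uniq_perm; rewrite ?divisors_uniq // => d.
  rewrite -dvdn_divisors ?muln_gt0 ?m_gt0 //; apply/idP/allpairsP.
    move=> d_dv; exists (gcdn d m, gcdn d n).
    by rewrite -!dvdn_divisors // !dvdn_gcdr dvdn_coprime_gcd.
  case=> -[x x'] /= []; rewrite -!dvdn_divisors // => xm x'n ->.
  exact: dvdn_mul.
rewrite /sigma (perm_big _ perm_prods) big_allpairs_dep big_distrl /=.
by apply: eq_bigr => d _; rewrite big_distrr.
Qed.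

Lemma sigma_prod (I : eqType) (r : seq I) (F : I -> nat) :
    uniq r -> (forall i, 0 < F i) ->
    (forall i j, i != j -> coprime (F i) (F j)) ->
  sigma (\prod_(i <- r) F i) = \prod_(i <- r) sigma (F i).
Proof.
move=> + F_gt0 coF; elim: r => [|i r IHr]; first by rewrite !big_nil sigma1.
case/andP=> ir /IHr sigma_r; rewrite !big_cons sigmaM ?sigma_r ?prodn_gt0 //.
rewrite big_seq; apply: (big_ind (coprime (F i))) => [|x y cx cy|j jr].
- exact: coprimen1.
- by rewrite coprimeMr cx.
- by apply: coF; apply: contraNneq ir => ->.
Qed.

Lemma leq_exp2_prod_primes (s : seq nat) :
  all prime s -> 2 ^ size s <= \prod_(x <- s) x.
Proof.
elim: s => [|x s IHs] /=; first by rewrite big_nil.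
by case/andP=> px ps; rewrite big_cons expnS leq_mul ?prime_gt1 ?IHs.
Qed.

(* Comparison of prime factor counts: the primes of [s] not cancelled by those
   of [t] must divide [a]. *)
Lemma dvdn_prod_primes (s t : seq nat) (a : nat) :
    all prime s -> all prime t -> 0 < a ->
    \prod_(x <- s) x %| a * \prod_(y <- t) y ->
  2 ^ size s <= a * 2 ^ size t.
Proof.
move=> + + a_gt0; elim: t s => [|q t IHt] s ps.
  rewrite big_nil !muln1 => _ /(dvdn_leq a_gt0).
  exact: leq_trans (leq_exp2_prod_primes _ ps).
case/andP=> pq pt; rewrite big_cons (mulnCA a q) /= expnS (mulnCA a 2).
have [qs | qs] := boolP (q \in s).
  rewrite (perm_big _ (perm_to_rem qs)) big_cons.
  rewrite dvdn_pmul2l ?prime_gt0 // => dv_s.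
  rewrite (perm_size (perm_to_rem qs)) /= expnS leq_mul2l IHt //.
  by apply/allP=> x /mem_rem; apply: (allP ps).
rewrite Gauss_dvdr => [/(IHt s ps pt) le_s|].
  by apply: leq_trans le_s _; apply: leq_pmull.
rewrite big_seq; apply: (big_ind (fun x => coprime x q)) => [|x y cx cy|x xs].
- exact: coprime1n.
- by rewrite coprimeMl cx.
- have px := allP ps x xs; rewrite prime_coprime ?dvdn_prime2 //.
  by apply: contraNneq qs => <-.
Qed.

Theorem theorem3p4 :
  ~ exists (n : nat) (p e : 'I_(omega n) -> nat),
      [/\ odd n,
          injective p /\ (forall i, prime (p i) /\ odd (p i)),
          n = \prod_(i < omega n) p i ^ e i,
          forall i, 2 <= e i /\ prime (sigma (p i ^ e i))
        & strong_alpha11 n].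
Proof.
case=> n [p] [e] [_ [p_inj p_pr] n_eq e_pr [_ [a1] [a2] [_ a2_gt0 _ sig_eq]]].
case/andP=> _; rewrite geq_max => /andP[_ a2_le].
have {}sig_eq : sigma n * a2 = a1 * n.
  apply/eqP; rewrite -(Num.Theory.eqr_nat rat) !GRing.natrM sig_eq GRing.mulrAC GRing.divfK //.
  by rewrite Num.Theory.pnatr_eq0 -lt0n.
have sigma_n : sigma n = \prod_(i < omega n) sigma (p i ^ e i).
  rewrite {1}n_eq; apply: sigma_prod => [|i|i j neq_ij].
  - exact: index_enum_uniq.
  - by rewrite expn_gt0 prime_gt0 //; case: (p_pr i).
  - apply/coprimeXl/coprimeXr.
    rewrite prime_coprime ?dvdn_prime2 ?(proj1 (p_pr _)) //.
    by rewrite (inj_eq p_inj).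
(* [ps] is used twice over because each exponent is at least 2; [qs] lists the prime factors of
   [sigma n]. *)
pose ps := [seq p i | i : 'I_(omega n)].
pose qs := [seq sigma (p i ^ e i) | i : 'I_(omega n)].
have dvd_n : \prod_(x <- ps ++ ps) x %| n.
  rewrite {1}n_eq big_cat /= big_image -big_split /=.
  apply: (big_ind2 (fun x y => x %| y)) => // [*|i _]; first exact: dvdn_mul.
  by rewrite mulnn dvdn_exp2l //; case: (e_pr i).
have: 2 ^ size (ps ++ ps) <= a2 * 2 ^ size qs.
  apply: dvdn_prod_primes => //.
  - by rewrite all_cat andbb; apply/allP=> _ /imageP[i _ ->]; case: (p_pr i).
  - by apply/allP=> _ /imageP[i _ ->]; case: (e_pr i).
  (* The product over [qs] is [sigma n], so the right side is [a1 * n], a multiple of [n]. *)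
  - rewrite big_image /= -sigma_n mulnC sig_eq.
    exact: dvdn_mull.
rewrite size_cat !size_image card_ord expnD leq_pmul2r ?expn_gt0 //.
by move/leq_trans/(_ a2_le); rewrite leqNgt ltn_expl.
Qed.
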